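(* Let $\mu\ge2$, let $\ell=(\ell_2,\dots,\ell_\mu)\in\mathbb{Z}^{\mu-1}\setminus\{0\}$, and write $\mathbb{T}^{\mu-1}_*=(S^1\setminus\{1\})^{\mu-1}$, $s_j=\operatorname{sgn}(\ell_j)$ and $|\ell|=|\ell_2|+\dots+|\ell_\mu|$. Let $$\Sigma_\ell=\{(\omega_2,\dots,\omega_\mu)\in\mathbb{T}^{\mu-1}_*\mid\omega_2^{\ell_2}\cdots\omega_\mu^{\ell_\mu}=1\}\,,$$ which consists of $|\ell|-1$ parallel hyperplanes. Then the function $\rho_\ell\colon\mathbb{T}^{\mu-1}_*\to\mathbb{Z}$ defined in the context is uniquely determined by the following properties: (1) it is constant on the connected components of $\mathbb{T}^{\mu-1}_*\setminus\Sigma_\ell$ and of $\Sigma_\ell$; (2) it takes its maximum value $|\ell|-1$ when $\omega_j\to1^{s_j}$ for all $j$ such that $\ell_j\neq0$; (3) moving away from the component of $\mathbb{T}^{\mu-1}_*\setminus\Sigma_\ell$ described in (2), it jumps by $-1$ when entering a component of $\Sigma_\ell$ and by $-1$ when exiting it, eventually reaching its minimal value $1-|\ell|$ on the component where $\omega_j\to1^{-s_j}$ for all $j$ such that $\ell_j\neq0$.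
   Context: Define $\rho\colon(S^1)^2\to\{-1,0,1\}$ by $\rho(z_1,z_2)=\operatorname{sgn}\big[i(z_1z_2-1)(\overline z_1-1)(\overline z_2-1)\big]$ (the bracket is real) and, for $n\ge1$, $\rho\colon(S^1)^n\to\mathbb{Z}$ by $\rho(z_1,\dots,z_n)=\sum_{j=1}^{n-1}\rho(z_j,z_{j+1}\cdots z_n)$. For $\ell\neq0$ and $\omega'=(\omega_2,\dots,\omega_\mu)\in\mathbb{T}^{\mu-1}_*$ set $$\rho_\ell(\omega')=\rho(\underbrace{\omega_2^{s_2},\dots,\omega_2^{s_2}}_{|\ell_2|},\dots,\underbrace{\omega_\mu^{s_\mu},\dots,\omega_\mu^{s_\mu}}_{|\ell_\mu|})\,.$$ The notation $\omega_j\to1^{+}$ (resp. $\omega_j\to1^-$) means $\omega_j=e^{i\theta}$ with $\theta\to0^+$ (resp. $\theta\to0^-$). Identifying $\mathbb{T}^{\mu-1}_*$ with the open cube $(0,1)^{\mu-1}$ via $\omega_j=e^{2\pi i\theta_j}$, ''hyperplanes'' are the intersections of the cube with affine hyperplanes $\sum_j\ell_j\theta_j=\text{const}$. *)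

(* Defs.v *)
From mathcomp Require Import all_boot all_order all_algebra.
From mathcomp Require Import all_classical all_reals all_analysis.
From mathcomp Require Import complex.
From mathcomp Require Import ring.

Set Implicit Arguments.
Unset Strict Implicit.
Unset Printing Implicit Defensive.

Import Order.TTheory GRing.Theory Num.Theory.
Import numFieldNormedType.Exports.

Local Open Scope classical_set_scope.
Local Open Scope ring_scope.

Section Rho.
Variable R : realType.
Implicit Types z : R[i].

Definition rho2_arg z1 z2 : R[i] :=
  'i%C * (z1 * z2 - 1) * ((z1^*)%C - 1) * ((z2^*)%C - 1).

(* On S^1 x S^1 the argument is real, so taking its real part below loses
   nothing. *)
Lemma rho2_arg_real z1 z2 :
  `|z1| = 1 -> `|z2| = 1 -> complex.Im (rho2_arg z1 z2) = 0.
Proof.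
have norm1 (x y : R) : `|(x +i* y)%C : R[i]| = 1 -> x ^+ 2 + y ^+ 2 = 1.
  rewrite normc_def => -[] h.
  by rewrite -[LHS]sqr_sqrtr ?addr_ge0 ?sqr_ge0 // h expr1n.
case: z1 => a b; case: z2 => c d /norm1 h1 /norm1 h2.
rewrite /rho2_arg /= !(mul0r, mul1r, sub0r, subr0, add0r, addr0).
have hb : b * b = 1 - a * a by rewrite -h1 -!expr2 addrAC subrr add0r.
have hd : d * d = 1 - c * c by rewrite -h2 -!expr2 addrAC subrr add0r.
ring: hb hd.
Qed.

Definition rho2 z1 z2 : int := sgz (complex.Re (rho2_arg z1 z2)).

(* Positions are counted from 0: the j-th summand is
   rho(s_j, s_(j+1) * ... * s_(n-1)), for 0 <= j < n - 1. *)
Definition rho (s : seq R[i]) : int :=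
  \sum_(j < (size s).-1) rho2 s`_j (\prod_(z <- drop j.+1 s) z).

Definition expi (t : R) : R[i] := (cos t +i* sin t)%C.

End Rho.

(* Below n stands for mu - 1, and the coordinates w_2, ..., w_mu are indexed by
   'I_n.  The alias ^o gives R[i] its usual norm topology, and row vectors carry
   the product topology. *)
Section Torus.
Variables (R : realType) (n : nat).
Local Notation V := 'rV[R[i]^o]_n.
Implicit Types (w : V) (l : 'rV[int]_n) (f : V -> int) (C D K A : set V).

Definition crd w (j : 'I_n) : R[i] := w 0 j.

Definition torus : set V :=
  [set w | forall j, `|crd w j| = 1 /\ crd w j != 1].

Definition abs1 l : nat := (\sum_j `|l 0%R j|)%N.

Definition Sigma l : set V :=
  [set w | torus w /\ \prod_j crd w j ^ l 0 j = 1].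

Definition rho_ l w : int :=
  rho (flatten
    [seq nseq `|l 0%R j|%N (crd w j ^ sgz (l 0 j)) | j <- enum 'I_n]).

Definition cube : set 'rV[R]_n := [set t | forall j, 0 < t 0 j < 1].

Definition cube_to_torus (t : 'rV[R]_n) : V :=
  \row_j expi (2 * pi * t 0 j).

Definition hyperplane l (c : R) : set 'rV[R]_n :=
  cube `&` [set t | \sum_j (l 0 j)%:~R * t 0 j = c].

Definition Sigma_hyperplanes l : Prop :=
  exists c : 'I_(abs1 l).-1 -> R,
    [/\ injective c,
        forall i, hyperplane l (c i) !=set0 &
        Sigma l = \bigcup_i (cube_to_torus @` hyperplane l (c i))].

Definition components A : set (set V) := connected_component A @` A.

Definition strata l : set (set V) :=
  components (torus `\` Sigma l) `|` components (Sigma l).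

(* The w in the torus with w_j = exp(i sigma s_j theta_j), 0 < theta_j < e,
   whenever l_j <> 0.  A property holds "when w_j -> 1^(sigma s_j) for all j
   with l_j <> 0" if it holds on corner l sigma e for some e > 0. *)
Definition corner l (sigma : int) (e : R) : set V :=
  [set w | torus w /\ forall j, l 0 j != 0 ->
    exists2 theta : R, 0 < theta < e &
      crd w j = expi ((sigma * sgz (l 0 j))%:~R * theta)].

Definition corner_component l (sigma : int) C : Prop :=
  components (torus `\` Sigma l) C /\
  exists2 e : R, 0 < e & corner l sigma e `<=` C.

Definition constant_on_components l f : Prop :=
  forall K, strata l K -> forall w w', K w -> K w' -> f w = f w'.

Definition maximum_prop l f : Prop :=
  (exists2 e : R, 0 < e &
     forall w, corner l 1 e w -> f w = (abs1 l)%:Z - 1) /\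
  (forall w, torus w -> f w <= (abs1 l)%:Z - 1).

(* A path in the torus starting in C and moving away from C: it never returns
   to a component (of the complement of Sigma, or of Sigma) it has left. *)
Definition moving_away l C (g : R -> V) : Prop :=
  [/\ {within `[0, 1], continuous g},
      forall t, 0 <= t <= 1 -> torus (g t),
      C (g 0) &
      forall K, strata l K -> forall r s t : R,
        0 <= r -> r <= s -> s <= t -> t <= 1 ->
        K (g r) -> K (g t) -> K (g s)].

Definition jumps l f (g : R -> V) : Prop :=
  forall K, components (Sigma l) K ->
    (forall a, 0 < a <= 1 -> K (g a) ->
       (forall t, 0 <= t < a -> ~ K (g t)) ->
       \forall t \near a^'-, f (g a) = f (g t) - 1) /\
    (forall b, 0 <= b < 1 -> K (g b) ->
       (forall t, b < t <= 1 -> ~ K (g t)) ->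
       \forall t \near b^'+, f (g t) = f (g b) - 1).

Definition jump_prop l f : Prop :=
  exists C D,
    [/\ corner_component l 1 C, corner_component l (-1) D,
        (forall g, moving_away l C g -> jumps l f g),
        (exists2 g, moving_away l C g & D (g 1)) &
        (forall w, D w -> f w = 1 - (abs1 l)%:Z) /\
        (forall w, torus w -> 1 - (abs1 l)%:Z <= f w)].

Definition characterizing_props l f : Prop :=
  [/\ constant_on_components l f, maximum_prop l f & jump_prop l f].

End Torus.

(* Main.v *)
Require Import Defs.
From mathcomp Require Import all_boot all_order all_algebra.
From mathcomp Require Import all_classical all_reals all_analysis.
From mathcomp Require Import complex.
From mathcomp Require Import ring lra zify.
Import Order.TTheory GRing.Theory Num.Theory.
Import numFieldNormedType.Exports.
Local Open Scope classical_set_scope.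
Local Open Scope ring_scope.

(** Write w_j = exp(2 i pi t_j) with 0 < t_j < 1, and let x_j be t_j or 1 - t_j
    according to the sign of l_j.  Put c(x) = floor x + ceil x.  For 0 < x < 1,
    rho2(exp(2 i pi x), exp(2 i pi y)) = 1 + c(y) - c(x + y), so that the sum
    defining rho telescopes and rho_l(w) = |l| - c(L), where L = \sum_j |l_j| x_j
    takes its values in the open interval (0, |l|).  Sigma_l is the set where L is
    an integer, and the components of Sigma_l and of its complement are the level
    sets of c(L): such a level set is convex in the cube, and a connected set
    meeting two of them contains both points with L an integer and points with L
    not an integer.  The segment on which all the x_j are equal and increasing
    moves away from the corner and crosses every level set, which determines any
    function with the prescribed jumps; conversely a path moving away from the
    corner can only cross an integer value of L upwards, since going back down
    would mean returning to the component just left. *)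

Set Implicit Arguments.
Unset Strict Implicit.
Unset Printing Implicit Defensive.

(** * Angles in turns and the signature rho *)

Section Turn.
Variable R : realType.
Implicit Types (x y t : R) (z : R[i]).

Definition turn t : R[i] := expi (2 * pi * t).

Lemma turnD x y : turn (x + y) = turn x * turn y.
Proof.
rewrite /turn mulrDr /expi cosD sinD; apply/eqP.
by rewrite eq_complex /= addrC eqxx andTb addrC.
Qed.

Lemma turn0 : turn 0 = 1.
Proof. by rewrite /turn mulr0 /expi cos0 sin0. Qed.

Lemma turn_neq0 t : turn t != 0.
Proof.
apply/eqP => t0; have := turnD t (- t); rewrite subrr turn0 t0 mul0r => /eqP.
by rewrite oner_eq0.
Qed.

Lemma turnN t : turn (- t) = (turn t)^-1.
Proof.
by apply: (mulfI (turn_neq0 t)); rewrite -turnD subrr turn0 divff ?turn_neq0.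
Qed.

Lemma turnMn t n : turn (t *+ n) = turn t ^+ n.
Proof. by elim: n => [|n IH]; rewrite ?turn0 // mulrS turnD IH exprS. Qed.

Lemma turn1 : turn 1 = 1.
Proof. by rewrite /turn mulr1 mulrC mulr_natr /expi cos2pi sin2pi. Qed.

Lemma turn_int (k : int) : turn k%:~R = 1.
Proof.
case: k => n; last rewrite NegzE mulrNz turnN.
  by rewrite -pmulrn turnMn turn1 expr1n.
by rewrite -pmulrn turnMn turn1 expr1n invr1.
Qed.

(** Half-angle form: the imaginary part and 1 minus the real part both contain the factor
    [sin (pi * t)]. *)
Lemma turnE t :
  turn t = Complex (1 - sin (pi * t) ^+ 2 *+ 2) ((cos (pi * t) * sin (pi * t)) *+ 2).
Proof.
rewrite /turn /expi -mulrA mulr_natl cos_mulr2n sin_mulr2n.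
by rewrite cos2sin2; congr Complex; ring.
Qed.

Lemma norm_turn t : `|turn t| = 1.
Proof. by rewrite normc_def /= cos2Dsin2 sqrtr1. Qed.

Lemma sin_pi_gt0 t : 0 < t < 1 -> 0 < sin (pi * t).
Proof.
move=> /andP[t0 t1]; apply: sin_gt0_pi.
by rewrite mulr_gt0 ?pi_gt0 //= -[ltRHS]mulr1 ltr_pM2l ?pi_gt0.
Qed.

Lemma turn_itv_neq1 t : 0 < t < 1 -> turn t != 1.
Proof.
move=> /sin_pi_gt0 s0; rewrite turnE eq_complex /=; apply/nandP; left.
by rewrite subr_eq addrC -subr_eq subrr eq_sym mulrn_eq0 /= sqrf_eq0 gt_eqF.
Qed.

Lemma turn_fracE t : turn (t - (Num.floor t)%:~R) = turn t.
Proof. by rewrite turnD -mulrNz turn_int mulr1. Qed.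

(** A nonzero fractional part would lie in the open unit interval, where [turn] avoids 1. Being an
    integer is expressed throughout as being equal to one's floor. *)
Lemma turn_eq1 t : turn t = 1 <-> t = (Num.floor t)%:~R.
Proof.
split=> [|->]; last exact: turn_int.
move=> t1; apply/eqP; rewrite eq_le floor_le andbT leNgt; apply/negP => lt_ft.
have /turn_itv_neq1 : 0 < t - (Num.floor t)%:~R < 1.
  by rewrite subr_gt0 lt_ft ltrBlDl; have := floorD1_gt t; rewrite rmorphD.
by rewrite turn_fracE t1 eqxx.
Qed.

(** Since exp(2ia) - 1 = 2i sin(a) exp(ia), the phases of the three factors cancel and the argument
    of the sign is 8 times the product of the sines. *)
Lemma rho2_turnE x y :
  rho2 (turn x) (turn y) =
  sgz (sin (pi * x) * (sin (pi * y) * sin (pi * (x + y)))).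
Proof.
rewrite /rho2 !turnE mulrDr sinD /rho2_arg /=.
rewrite !(mul0r, mul1r, sub0r, subr0, add0r, addr0).
move: (cos2Dsin2 (pi * x)) (cos2Dsin2 (pi * y)).
set c := cos (pi * x); set s := sin (pi * x).
set d := cos (pi * y); set u := sin (pi * y) => cs du.
have hs : s * s = 1 - c * c by rewrite -cs -!expr2 addrAC subrr add0r.
have hu : u * u = 1 - d * d by rewrite -du -!expr2 addrAC subrr add0r.
have sgz8 (X : R) : sgz (8 * X) = sgz X by rewrite sgzM [sgz 8]gtr0_sgz ?mul1r.
rewrite -[RHS]sgz8.
congr sgz.
ring: hs hu.
Qed.

(** Numbers the cells of the line cut at the integers, from left to right: the integer k has number
    2k, the open interval from k to k + 1 has number 2k + 1. *)
Definition cell x : int := Num.floor x + Num.ceil x.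

Lemma cell_int (k : int) : cell k%:~R = k + k.
Proof. by rewrite /cell intrKfloor intrKceil. Qed.

Lemma cell0 : cell 0 = 0.
Proof. exact: (cell_int 0). Qed.

Lemma cell1 : cell 1 = 2.
Proof. exact: (cell_int 1). Qed.

Lemma cell_itv (k : int) x : k%:~R < x < (k + 1)%:~R -> cell x = k + k + 1.
Proof.
move=> /andP[kx xk].
by rewrite /cell (@floor_def _ _ k) ?(@ceil_def _ _ (k + 1)) ?addrA //
  ?addrK ?kx ?(ltW kx) ?(ltW xk).
Qed.

Variant cell_spec x : int -> Prop :=
 | CellInt (k : int) of x = k%:~R : cell_spec x (k + k)
 | CellItv (k : int) of k%:~R < x < (k + 1)%:~R : cell_spec x (k + k + 1).

Lemma cellP x : cell_spec x (cell x).
Proof.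
have := floor_itv x => /andP[]; rewrite le_eqVlt => /predU1P[<- _|h1 h2].
  by rewrite cell_int; constructor.
by rewrite (@cell_itv (Num.floor x)) ?h1 //; constructor; rewrite h1.
Qed.

Lemma le_cell : {homo cell : x y / x <= y}.
Proof. by move=> x y xy; rewrite lerD ?le_floor ?le_ceil. Qed.

Lemma cellDz x (k : int) : cell (x + k%:~R) = cell x + (k + k).
Proof. by rewrite /cell floorDrz ?ceilDrz ?intr_int // intrKfloor intrKceil addrACA. Qed.

Lemma cell_eq_even x (k : int) : cell x = k + k -> x = k%:~R.
Proof. by case: cellP => [m -> mk|m _ mk]; [congr _%:~R; lia|lia]. Qed.

Lemma cell_eq_odd x (k : int) :
  cell x = k + k + 1 -> k%:~R < x < (k + 1)%:~R.
Proof.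
case: cellP => [m _ mk|m xm mk]; first lia.
by have <- : m = k by lia.
Qed.

(** Integers and open intervals alternate, so values of both kinds occur between points of different
    cells. Hence an interval with values of one kind only stays in one cell. *)
Lemma cell_lt_values x y : cell x < cell y ->
  (exists2 z, x <= z <= y & z = (Num.floor z)%:~R) /\
  (exists2 z, x <= z <= y & z <> (Num.floor z)%:~R).
Proof.
have nonint (z : R) (k : int) : k%:~R < z < (k + 1)%:~R -> z <> (Num.floor z)%:~R.
  by move=> kz zE; have := cell_itv kz; rewrite zE cell_int; lia.
case: (cellP x) => [k ->|k kx] xy.
  split.
    exists k%:~R; last by rewrite intrKfloor.
    rewrite lexx /= leNgt; apply/negP => /ltW /le_cell; rewrite cell_int; lia.
  have ky : k%:~R < y.
    by rewrite ltNge; apply/negP => /le_cell; rewrite cell_int; lia.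
  have [y1|y1] := ltP y (k + 1)%:~R.
    exists y; first by rewrite lexx (ltW ky).
    by apply: (nonint _ k); rewrite ky.
  rewrite rmorphD /= in y1.
  (* Here [x] is the integer [k] and [y] is at least k + 1, so the midpoint of the unit interval
     after [x] is within range. *)
  exists (k%:~R + 2^-1); first by apply/andP; split; lra.
  by apply: (nonint _ k); rewrite rmorphD /=; apply/andP; split; lra.
have ky : (k + 1)%:~R <= y.
  rewrite leNgt; apply/negP => yk.
  have h1 : (Num.floor y < k + 1)%R by rewrite floor_lt_int.
  have h2 : (Num.ceil y <= k + 1)%R by rewrite ceil_le_int ltW.
  by move: xy; rewrite /cell; lia.
have /andP[kx1 kx2] := kx; split.
  by exists (k + 1)%:~R; [rewrite (ltW kx2) ky|rewrite intrKfloor].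
exists x; first by rewrite lexx (le_trans (ltW kx2) ky).
exact: nonint kx.
Qed.

(** Both sides are unchanged when an integer is added to [y], which reduces to 0 <= y < 1. For y > 0
    the sign is then that of sin(pi (x + y)), decided by comparing x + y with 1. *)
Lemma rho2_turn x y : 0 < x < 1 ->
  rho2 (turn x) (turn y) = 1 + cell y - cell (x + y).
Proof.
move=> x01; rewrite -(turn_fracE y).
have : 0 <= y - (Num.floor y)%:~R < 1.
  by rewrite subr_ge0 floor_le ltrBlDl; have := floorD1_gt y; rewrite rmorphD.
have cellE t : cell (t + y) =
    cell (t + (y - (Num.floor y)%:~R)) + (Num.floor y + Num.floor y).
  by rewrite -cellDz -addrA subrK.
move: (cellE 0) (cellE x); rewrite !add0r => -> ->.
move: (Num.floor y) (y - _) => k u.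
have -> (a b : int) : 1 + (a + (k + k)) - (b + (k + k)) = 1 + a - b by ring.
move=> /andP[]; rewrite le_eqVlt rho2_turnE => /predU1P[<- _|u0 u1].
  by rewrite mulr0 sin0 mul0r mulr0 sgz0 addr0 (@cell_itv 0 x) // cell0.
have sx := sin_pi_gt0 x01; have su : 0 < sin (pi * u) by rewrite sin_pi_gt0 ?u0.
rewrite 2!sgzM (gtr0_sgz sx) (gtr0_sgz su) !mul1r (@cell_itv 0 u) ?u0 //.
case: (ltgtP (x + u) 1) => xu.
- rewrite gtr0_sgz; last by rewrite sin_pi_gt0 // xu andbT; lra.
  by rewrite (@cell_itv 0) ?xu ?andbT //; lra.
- rewrite (_ : pi * (x + u) = pi * (x + u - 1) + pi); last by ring.
  rewrite sinDpi sgzN gtr0_sgz; last by rewrite sin_pi_gt0 //; lra.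
  by rewrite (@cell_itv 1) // xu /=; lra.
by rewrite xu mulr1 sinpi sgz0 cell1.
Qed.

Lemma prod_turn (s : seq R) :
  \prod_(z <- map turn s) z = turn (\sum_(t <- s) t).
Proof.
elim: s => [|t s IH]; first by rewrite !big_nil turn0.
by rewrite /= !big_cons IH turnD.
Qed.

(** Each [rho2_turn] trades the cell of a tail sum for that of the next longer one, so the sum
    telescopes; a single angle gives 0 = 1 - 1. *)
Lemma rho_turn (s : seq R) : s != [::] -> all (fun t => 0 < t < 1) s ->
  rho (map turn s) = (size s)%:Z - cell (\sum_(t <- s) t).
Proof.
elim: s => [//|t [|u s] IH] _.
  move=> /= /andP[t01 _]; rewrite /rho big_ord0 big_seq1 (@cell_itv 0) //.
rewrite [all _ _]/= => /andP[t01 us].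
have -> : rho (map turn [:: t, u & s]) =
    rho2 (turn t) (turn (\sum_(x <- u :: s) x)) + rho (map turn (u :: s)).
  by rewrite {1}/rho big_ord_recl -prod_turn.
by rewrite IH // rho2_turn // [in RHS]big_cons /=; ring.
Qed.

End Turn.

(** * Recovering the angle of a point of the circle *)

Section Angle.
Variable R : realType.
Implicit Types (x y t : R) (z : R[i]) (m : int).

(* Half-angle formula: y / (1 - x) is the cotangent of half the argument of x + i y. *)
Definition ang z : R := 2^-1 - atan (complex.Im z / (1 - complex.Re z)) / pi.

Lemma ang_turn t : 0 < t < 1 -> ang (turn t) = t.
Proof.
move=> t01; have s0 := sin_pi_gt0 t01; have p0 := pi_gt0 R.
rewrite /ang turnE /=.
(* The quotient is the cotangent of [pi * t]; written as a tangent, its argument lies in the range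
   where [atan] inverts [tan]. *)
rewrite (_ : _ / (1 - _) = tan (pi / 2 - pi * t)); last first.
  rewrite /tan sinB cosB sin_pihalf cos_pihalf !mul1r !mul0r subr0 add0r; field.
  by rewrite gt_eqF //= opprB addrCA subrr addr0 mulf_neq0 // sqrf_eq0 gt_eqF.
rewrite tanK.
  by move: pi p0 {s0} => p p0; field; rewrite gt_eqF.
by rewrite in_itv /=; move: t01 => /andP[t0 t1]; apply/andP; split; nra.
Qed.

Lemma norm1_sqr z : `|z| = 1 -> complex.Re z ^+ 2 + complex.Im z ^+ 2 = 1.
Proof.
by rewrite normc_def => -[h]; rewrite -[LHS]sqr_sqrtr ?addr_ge0 ?sqr_ge0 // h expr1n.
Qed.

Lemma unit_Re_neq1 z : `|z| = 1 -> z != 1 -> complex.Re z != 1.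
Proof.
move=> /norm1_sqr; case: z => x y /= xy; apply: contra => /eqP x1.
move: xy; rewrite x1 expr1n eq_complex /= eqxx /= => h1.
have /eqP : y ^+ 2 = 0 by lra.
by rewrite sqrf_eq0.
Qed.

(** The bounds come from the open range of [atan], whatever the quotient, including the value 0
    given by division by zero. *)
Lemma ang_itv z : 0 < ang z < 1.
Proof.
rewrite /ang; have p0 := pi_gt0 R.
set a := atan _; have h1 : a / pi < 2^-1.
  by rewrite ltr_pdivrMr // mulrC atan_ltpi2.
have h2 : - 2^-1 < a / pi.
  by rewrite ltr_pdivlMr // mulNr mulrC atan_gtNpi2.
by apply/andP; split; lra.
Qed.

Lemma turn_ang z : `|z| = 1 -> z != 1 -> turn (ang z) = z.
Proof.
move=> z1 /(unit_Re_neq1 z1); rewrite /ang turnE.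
move/norm1_sqr: z1; case: z => x y /= xy x1.
have x1' : 1 - x != 0 by rewrite subr_eq0 eq_sym.
set q := y / (1 - x); set a := atan q; have p0 := pi_gt0 R.
have -> : pi * (2^-1 - a / pi) = pi / 2 - a by move: pi p0 => p p0; field; rewrite gt_eqF.
rewrite sinB cosB sin_pihalf cos_pihalf !mul1r !mul0r subr0 add0r.
(* From x^2 + y^2 = 1 follows 1 + q^2 = 2 / (1 - x), whose inverse is the squared cosine of
   [atan q]. *)
have ca : cos a ^+ 2 = (1 - x) / 2.
  rewrite /a cos_atan exprVn sqr_sqrtr ?addr_ge0 ?sqr_ge0 // /q.
  rewrite exprMn (_ : y ^+ 2 = 1 - x ^+ 2); last by rewrite -xy; ring.
  have x2 : 1 - x ^+ 2 + (1 - x) ^+ 2 = 2 * (1 - x) by ring.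
  field; rewrite x1' /= addrC x2 mulf_neq0 //.
have c0 : cos a != 0.
  by rewrite -sqrf_eq0 ca mulf_neq0 // invr_neq0.
have sa : sin a = q * cos a by rewrite -{1}(atanK q) /tan -/a mulfVK.
congr Complex; first by rewrite ca -mulr_natr mulfVK // opprB addrCA subrr addr0.
by rewrite sa -mulrA -expr2 ca /q; field.
Qed.

(** The inverse of [turn x] has angle - x; 1 - x is its representative in the open unit interval. *)
Definition flip m x : R := if m < 0 then 1 - x else x.

Lemma flipK m : involutive (flip m).
Proof. by move=> x; rewrite /flip; case: (m < 0); rewrite ?subKr. Qed.

Lemma flip_itv m x : (0 < flip m x < 1) = (0 < x < 1).
Proof.
by rewrite /flip; case: (m < 0); rewrite // subr_gt0 ltrBlDr ltrDl andbC.
Qed.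

Lemma turn_flip m x : m != 0 -> turn (flip m x) = turn x ^ sgz m.
Proof.
rewrite /flip neq_lt; case: ltP => [m0 _|_ /= m0].
  by rewrite ltr0_sgz // turnD turn1 mul1r turnN.
by rewrite gtr0_sgz.
Qed.

Lemma turn_flipMn m x : turn (flip m x *+ `|m|) = turn x ^ m.
Proof.
have [->|m0] := eqVneq m 0; first by rewrite mulr0n turn0.
have -> : turn x ^ m = turn x ^ (sgz m * `|m|%N) by rewrite -intEsg.
by rewrite turnMn turn_flip // -exprz_exp.
Qed.

End Angle.

(** * Level function of the torus *)

Section Level.
Variables (R : realType) (n : nat) (l : 'rV[int]_n).
Local Notation V := 'rV[R[i]^o]_n.
Implicit Types (w : V) (a b : 'rV[R]_n).

Definition angles w : 'rV[R]_n := \row_j ang (crd w j).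

(** Up to the additive integer [neg1], this is the linear form with coefficients [l]; the flips
    place its values on the cube strictly between 0 and [abs1 l] for nonzero [l]. *)
Definition height a : R := \sum_j flip (l 0 j) (a 0 j) *+ `|l 0 j|.

Definition level w : R := height (angles w).

Lemma crd_cube_to_torus a j : crd (cube_to_torus a) j = turn (a 0 j).
Proof. by rewrite /crd mxE. Qed.

Lemma torus_cube_to_torus a : cube a -> torus (cube_to_torus a).
Proof.
by move=> ca j; rewrite crd_cube_to_torus norm_turn turn_itv_neq1 ?ca.
Qed.

Lemma cube_angles w : cube (angles w).
Proof. by move=> j; rewrite mxE ang_itv. Qed.

Lemma angles_cube_to_torus a : cube a -> angles (cube_to_torus a) = a.
Proof.
by move=> ca; apply/rowP => j; rewrite mxE crd_cube_to_torus ang_turn ?ca.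
Qed.

Lemma cube_to_torus_angles w : torus w -> cube_to_torus (angles w) = w.
Proof.
move=> tw; apply/rowP => j; have [w1 wn1] := tw j.
by rewrite -[LHS]/(crd _ _) crd_cube_to_torus mxE turn_ang.
Qed.

Lemma level_cube_to_torus a : cube a -> level (cube_to_torus a) = height a.
Proof. by move=> ca; rewrite /level angles_cube_to_torus. Qed.

Lemma prod_crd w : torus w -> \prod_j crd w j ^ l 0 j = turn (level w).
Proof.
move=> tw; rewrite /level /height.
rewrite (big_morph (@turn R) (@turnD R) (@turn0 R)); apply: eq_bigr => j _.
by rewrite turn_flipMn -crd_cube_to_torus cube_to_torus_angles.
Qed.

Lemma SigmaE w : Sigma l w <-> torus w /\ level w = (Num.floor (level w))%:~R.
Proof.
by split=> -[tw h]; split => //; move: h; rewrite prod_crd // turn_eq1.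
Qed.

Lemma abs1_gt0 : l != 0 -> (0 < abs1 l)%N.
Proof.
apply: contraNT; rewrite -eqn0Ngt /abs1 sum_nat_eq0 => /forallP h.
by apply/eqP/rowP => j; rewrite mxE; apply/eqP; rewrite -absz_eq0; exact: h.
Qed.

Lemma sumMn_lt (F G : 'I_n -> R) : l != 0 ->
  (forall j, l 0 j != 0 -> F j < G j) ->
  \sum_j F j *+ `|l 0 j| < \sum_j G j *+ `|l 0 j|.
Proof.
move=> l0 FG; have /rV0Pn[j lj] := l0.
rewrite [ltLHS](bigD1 j) // [ltRHS](bigD1 j) //=; apply: ltr_leD.
  by rewrite ltrMn2r absz_gt0 lj FG.
apply: ler_sum => k _; have [->|lk] := eqVneq (l 0 k) 0; first by rewrite !mulr0n.
by rewrite lerMn2r (ltW (FG _ lk)) orbT.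
Qed.

Lemma sumMn_const x : \sum_j x *+ `|l 0 j| = x *+ abs1 l :> R.
Proof. by rewrite -sumrMnr. Qed.

Lemma height_itv a : l != 0 -> cube a -> 0 < height a < (abs1 l)%:R.
Proof.
move=> l0 ca; rewrite -(mul0rn _ (abs1 l)) -!sumMn_const.
by apply/andP; split; apply: sumMn_lt => // j _;
  have := ca j; rewrite -(flip_itv (l 0 j)) => /andP[].
Qed.

Lemma level_itv w : l != 0 -> 0 < level w < (abs1 l)%:R.
Proof. by move=> l0; apply: height_itv => //; exact: cube_angles. Qed.

(** The list defining [rho_] is the image under [turn] of the flipped angles, each repeated
    according to its weight; [rho_turn] applies, and the sum of these angles is the level. *)
Lemma rhoE w : l != 0 -> torus w -> rho_ l w = (abs1 l)%:Z - cell (level w).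
Proof.
move=> l0 tw; rewrite /rho_.
set ts := flatten [seq nseq `|l 0 j| (flip (l 0 j) (angles w 0 j)) | j <- enum 'I_n].
have -> : flatten [seq nseq `|l 0 j| (crd w j ^ sgz (l 0 j)) | j <- enum 'I_n]
    = map (@turn R) ts.
  rewrite map_flatten -map_comp; congr flatten; apply: eq_map => j /=.
  rewrite map_nseq; have [->|lj] := eqVneq (l 0 j) 0; first by [].
  by rewrite turn_flip // -crd_cube_to_torus cube_to_torus_angles.
have szts : size ts = abs1 l.
  rewrite size_flatten /shape -map_comp sumnE big_map big_enum /=.
  by apply: eq_bigr => j _; rewrite size_nseq.
rewrite rho_turn.
- rewrite szts /level /height big_flatten big_map big_enum /=; congr (_ - cell _).
  by apply: eq_bigr => j _; rewrite big_nseq iter_addr_0.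
- by rewrite -size_eq0 szts -lt0n abs1_gt0.
apply/allP => t /flattenP[s /mapP[j _ ->]] /nseqP[-> _].
by rewrite flip_itv cube_angles.
Qed.

(** For negative l_j, flipping turns l_j a_j into |l_j| (1 - a_j) = l_j a_j + |l_j|; these constants
    add up to [neg1]. *)
Definition neg1 : nat := (\sum_(j | (l 0 j < 0)%R) `|l 0%R j|)%N.

Lemma height_linear a : height a = \sum_j (l 0 j)%:~R * a 0 j + neg1%:R.
Proof.
rewrite /neg1 natr_sum [X in _ + X]big_mkcond -big_split /=.
apply: eq_bigr => j _; rewrite /flip; case: (l 0 j) => m /=.
  by rewrite addr0 mulr_natl.
rewrite NegzE mulrNz -pmulrn mulrnBl -mulr_natl; lra.
Qed.

Definition diag (x : R) : 'rV[R]_n := \row_j flip (l 0 j) x.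

Lemma cube_diag x : 0 < x < 1 -> cube (diag x).
Proof. by move=> x01 j; rewrite mxE flip_itv. Qed.

Lemma height_diag x : height (diag x) = x *+ abs1 l.
Proof. by rewrite -sumMn_const; apply: eq_bigr => j _; rewrite mxE flipK. Qed.

End Level.

(** * Continuity *)

Section Continuity.
Variable R : realType.

Lemma continuous_Re : continuous (fun z : R[i]^o => complex.Re z : R).
Proof.
move=> z A /nbhs_ballP[e e0 eA]; apply/nbhs_ballP.
(* Radii of balls in [R[i]] are positive elements of [R[i]], so the real radius has to be
   embedded. *)
exists e%:C%C; first by rewrite /= ltcR.
move=> y; rewrite -ball_normE /= => zy; apply: eA; rewrite -ball_normE /=.
by rewrite -ltcR; apply: le_lt_trans zy; rewrite -raddfB; exact: normc_ge_Re.
Qed.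

Lemma normc_ge_Im (z : R[i]) : `|complex.Im z|%:C%C <= `|z|.
Proof.
by case: z => a b; rewrite normc_def lecR /= -sqrtr_sqr ler_wsqrtr // lerDr sqr_ge0.
Qed.

Lemma continuous_Im : continuous (fun z : R[i]^o => complex.Im z : R).
Proof.
move=> z A /nbhs_ballP[e e0 eA]; apply/nbhs_ballP.
exists e%:C%C; first by rewrite /= ltcR.
move=> y; rewrite -ball_normE /= => zy; apply: eA; rewrite -ball_normE /=.
by rewrite -ltcR; apply: le_lt_trans zy; rewrite -raddfB; exact: normc_ge_Im.
Qed.

Lemma continuous_Complex (T : topologicalType) (f g : T -> R) (x : T) :
  {for x, continuous f} -> {for x, continuous g} ->
  {for x, continuous (fun t => (f t +i* g t)%C : R[i]^o)}.
Proof.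
move=> cf cg A /nbhs_ballP[e e0 eA].
(* Conversely, a positive complex radius has zero imaginary part. *)
have [eR eE] : 0 < complex.Re e /\ e = (complex.Re e)%:C%C.
  by case: e e0 {eA} => a b; rewrite /= ltcE /= => /andP[/eqP-> ->].
have e2 : 0 < complex.Re e / 2 by rewrite divr_gt0.
have nf : \forall t \near x, `|f x - f t| < complex.Re e / 2 by exact: cvgr_dist_lt.
have ng : \forall t \near x, `|g x - g t| < complex.Re e / 2 by exact: cvgr_dist_lt.
apply: filterS2 nf ng => t ft gt; apply: eA; rewrite -ball_normE /= eE.
have -> : (f x +i* g x)%C - (f t +i* g t)%C =
    (f x - f t)%:C%C + 'i%C * (g x - g t)%:C%C :> R[i].
  by apply/eqP; rewrite eq_complex /= !mul0r !mul1r subrr !addr0 !add0r !eqxx.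
have norm_real (a : R) : `|a%:C%C : R[i]| = `|a|%:C%C.
  by rewrite normc_def /= expr0n /= addr0 sqrtr_sqr.
apply: (le_lt_trans (ler_normD _ _)).
have ni : `|'i%C : R[i]| = 1 by rewrite normc_def /= expr0n /= add0r expr1n sqrtr1.
by rewrite normrM ni mul1r !norm_real -rmorphD ltcR; lra.
Qed.

Lemma continuous_expi : continuous (fun t : R => expi t : R[i]^o).
Proof.
by move=> x; apply: continuous_Complex; [exact: continuous_cos|exact: continuous_sin].
Qed.

Lemma continuous_ang_comp (T : topologicalType) (f : T -> R[i]^o) (x : T) :
  complex.Re (f x) != 1 -> {for x, continuous f} ->
  {for x, continuous (fun t => ang (f t) : R)}.
Proof.
move=> fx1 cf.
have cRe : {for x, continuous (fun t => complex.Re (f t) : R)}.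
  exact: (continuous_comp cf (@continuous_Re _)).
have cIm : {for x, continuous (fun t => complex.Im (f t) : R)}.
  exact: (continuous_comp cf (@continuous_Im _)).
rewrite /ang; apply: cvgB; first exact: cvg_cst.
apply: cvgMr_tmp; apply: continuous_comp; last exact: continuous_atan.
apply: cvgM; first exact: cIm.
apply: cvgV; first by rewrite subr_eq0 eq_sym.
by apply: cvgB; [exact: cvg_cst|exact: cRe].
Qed.

Lemma continuous_row (T U : topologicalType) n (f : 'I_n -> T -> U) (x : T) :
  (forall j, {for x, continuous (f j)}) ->
  {for x, continuous (fun t => \row_j f j t)}.
Proof.
move=> cf A [P xP PA].
have /filter_forall : forall j, \forall t \near x, P 0 j (f j t).
  by move=> j; apply: cf; have := xP 0 j; rewrite mxE.
apply: filterS => t Pt; apply: PA => i j; rewrite mxE ord1; exact: Pt.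
Qed.

Lemma continuous_crd n (j : 'I_n) :
  continuous (fun w : 'rV[R[i]^o]_n => crd w j : R[i]^o).
Proof.
move=> w A wA; exists (fun _ k => if k == j then A else setT).
  move=> i k; case: eqP => [->|_]; last exact: filterT.
  by rewrite (ord1 i).
by move=> v /(_ 0 j); rewrite eqxx.
Qed.

(** On the torus no coordinate has real part 1, so the quotient inside [ang] is continuous there. *)
Lemma continuous_level n (l : 'rV[int]_n) (T : topologicalType)
    (g : T -> 'rV[R[i]^o]_n) (x : T) :
  torus (g x) -> {for x, continuous g} ->
  {for x, continuous (fun t => level l (g t))}.
Proof.
move=> tg cg; rewrite /level /height.
apply: cvg_big => [|j _]; first exact: add_continuous.
have ca : {for x, continuous (fun t => angles (g t) 0 j)}.
  rewrite (_ : (fun t => _) = fun t => ang (crd (g t) j)); last first.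
    by apply/funext => t; rewrite mxE.
  apply: continuous_ang_comp; first by have [] := tg j => *; exact: unit_Re_neq1.
  exact: (continuous_comp cg (@continuous_crd _ _ _)).
apply: cvgMn; rewrite /flip; case: ifP => _; last exact: ca.
by apply: cvgB; [exact: cvg_cst|exact: ca].
Qed.

(** * Straight segments in the cube *)

Definition segment n (a b : 'rV[R]_n) (t : R) : 'rV[R[i]^o]_n :=
  cube_to_torus (a + t *: (b - a)).

Lemma continuous_segment n (a b : 'rV[R]_n) : continuous (segment a b).
Proof.
move=> t; apply: continuous_row => j.
have ca : continuous (fun s : R => 2 * pi * (a 0 j + s * (b 0 j - a 0 j))).
  move=> s; apply: cvgMl_tmp; apply: cvgD; first exact: cvg_cst.
  by apply: cvgMr_tmp; exact: cvg_id.
rewrite (_ : (fun t : R => _) =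
    (fun t => expi t) \o fun s : R => 2 * pi * (a 0 j + s * (b 0 j - a 0 j))).
  by apply: continuous_comp; [exact: ca|exact: continuous_expi].
by apply/funext => s; rewrite /= !mxE.
Qed.

Lemma cube_segment n (a b : 'rV[R]_n) (t : R) :
  cube a -> cube b -> 0 <= t <= 1 -> cube (a + t *: (b - a)).
Proof.
move=> ca cb /andP[t0 t1] j; rewrite !mxE.
have /andP[a0 a1] := ca j; have /andP[b0 b1] := cb j.
have [ab|/ltW ba] := leP (a 0 j) (b 0 j).
  have h0 : 0 <= t * (b 0 j - a 0 j) by rewrite mulr_ge0 ?subr_ge0.
  have h1 : 0 <= (1 - t) * (b 0 j - a 0 j) by rewrite mulr_ge0 ?subr_ge0.
  by apply/andP; split; lra.
have h0 : 0 <= t * (a 0 j - b 0 j) by rewrite mulr_ge0 ?subr_ge0.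
have h1 : 0 <= (1 - t) * (a 0 j - b 0 j) by rewrite mulr_ge0 ?subr_ge0.
by apply/andP; split; lra.
Qed.

Lemma height_segment n (l : 'rV[int]_n) (a b : 'rV[R]_n) (t : R) :
  height l (a + t *: (b - a)) = height l a + t * (height l b - height l a).
Proof.
rewrite !height_linear.
have -> : \sum_j (l 0 j)%:~R * (a + t *: (b - a)) 0 j = \sum_j (l 0 j)%:~R * a 0 j +
    t * (\sum_j (l 0 j)%:~R * b 0 j - \sum_j (l 0 j)%:~R * a 0 j).
  rewrite -sumrB mulr_sumr -big_split /=; apply: eq_bigr => j _.
  by rewrite !mxE; ring.
by ring.
Qed.

End Continuity.

(** * Components *)

Section Strata.
Variables (R : realType) (n : nat) (l : 'rV[int]_n).
Local Notation V := 'rV[R[i]^o]_n.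
Local Notation N := (abs1 l).
Implicit Types (w : V) (K C : set V) (g : R -> V).

Lemma is_interval_level K : connected K -> K `<=` torus (R:=R) (n:=n) ->
  is_interval (level l @` K).
Proof.
move=> cK Kt; apply/connected_intervalP; apply: connected_continuous_connected => //.
apply: continuous_in_subspaceT => w /set_mem Kw.
by apply: (@continuous_level _ _ _ _ id); [exact: Kt|exact: cvg_id].
Qed.

(** For c = 2k this is the hyperplane of level k, for c = 2k + 1 the open slab between levels k and
    k + 1. *)
Definition layer (c : int) : set V := [set w | torus w /\ cell (level l w) = c].

Lemma mem_layer w : torus w -> layer (cell (level l w)) w.
Proof. by []. Qed.

(** The connected set is the segment joining the angles. The level is affine along it and [cell] is
    monotone, so the cell is squeezed between two equal values. *)
Lemma layer_connected w w' : layer (cell (level l w)) w' -> torus w ->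
  exists K, [/\ K w, K w', connected K & K `<=` layer (cell (level l w))].
Proof.
move=> [tw' ww'] tw.
pose s := segment (angles w) (angles w').
have s_level t : 0 <= t <= 1 ->
    torus (s t) /\ level l (s t) = level l w + t * (level l w' - level l w).
  move=> t01; have c := cube_segment (@cube_angles _ _ w) (@cube_angles _ _ w') t01.
  by split; [exact: torus_cube_to_torus|rewrite level_cube_to_torus // height_segment].
exists (s @` `[0, 1]); split.
- exists 0; first by rewrite /= in_itv /= lexx ler01.
  by rewrite /s /segment scale0r addr0 cube_to_torus_angles.
- exists 1; first by rewrite /= in_itv /= lexx ler01.
  by rewrite /s /segment scale1r addrC subrK cube_to_torus_angles.
- apply: connected_continuous_connected; first exact: segment_connected.
  by apply: continuous_subspaceT; exact: continuous_segment.
move=> _ [t /= + <-]; rewrite in_itv /= => t01.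
have [ts sE] := s_level t t01; split => //; apply/eqP; rewrite eq_le.
have /andP[t0 t1] := t01.
have [ab|/ltW ba] := leP (level l w) (level l w').
  have h0 : 0 <= t * (level l w' - level l w) by rewrite mulr_ge0 ?subr_ge0.
  have h1 : 0 <= (1 - t) * (level l w' - level l w) by rewrite mulr_ge0 ?subr_ge0.
  by rewrite -{1}ww' !le_cell // sE; lra.
have h0 : 0 <= t * (level l w - level l w') by rewrite mulr_ge0 ?subr_ge0.
have h1 : 0 <= (1 - t) * (level l w - level l w') by rewrite mulr_ge0 ?subr_ge0.
by rewrite -{2}ww' !le_cell // sE; lra.
Qed.

Lemma layer_Sigma w w' : layer (cell (level l w)) w' -> Sigma l w -> Sigma l w'.
Proof.
move=> [tw' ww'] /SigmaE[_ wE]; apply/SigmaE; split => //.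
move: ww'; rewrite wE cell_int => /cell_eq_even ->.
by rewrite intrKfloor.
Qed.

Lemma component_layer (A : set V) w :
  A = Sigma l \/ A = torus (R:=R) (n:=n) `\` Sigma l -> A w ->
  connected_component A w = layer (cell (level l w)).
Proof.
move=> AE Aw.
have At : A `<=` torus (R:=R) (n:=n) by case: AE => -> v [].
apply/seteqP; split => [w' [K [Kw KA cK] Kw']|w' lw'].
  split; first exact/At/KA.
  have iK := is_interval_level cK (subset_trans KA At).
  (* The levels of [K] form an interval; if it met two cells, [K] would contain both a point of
     Sigma and a point off it. *)
  have no_lt v v' : K v -> K v' -> ~ cell (level l v) < cell (level l v').
    move=> Kv Kv' /cell_lt_values[[z zi zE] [z' zi' zE']].
    have [u Ku uz] : (level l @` K) z by apply: iK zi; [exists v|exists v'].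
    have [u' Ku' uz'] : (level l @` K) z' by apply: iK zi'; [exists v|exists v'].
    case: AE => AE.
      by have := KA _ Ku'; rewrite AE SigmaE uz' => -[].
    have := KA _ Ku; rewrite AE => -[tu]; apply.
    by apply/SigmaE; rewrite uz.
  by case: (ltgtP (cell (level l w')) (cell (level l w))) => // /no_lt; case.
have [K [Kw Kw' cK Kl]] := layer_connected lw' (At _ Aw).
exists K => //; split => // v /Kl lv; case: AE Aw => -> // Aw.
  exact: layer_Sigma lv _.
split; first by case: lv.
by move=> Sv; apply: Aw.2; apply: layer_Sigma Sv; split; [case: Aw|case: lv].
Qed.

Lemma components_SigmaP K :
  components (Sigma l) K <-> exists2 w : V, Sigma l w & K = layer (cell (level l w)).
Proof.
by split=> [[w Sw <-]|[w Sw ->]]; exists w => //; rewrite component_layer //; left.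
Qed.

Lemma components_compl_SigmaP K : components (torus (R:=R) (n:=n) `\` Sigma l) K <->
  exists w, [/\ torus w, ~ Sigma l w & K = layer (cell (level l w))].
Proof.
split=> [[w Aw <-]|[w [tw Sw ->]]]; exists w => //.
  by have [tw Sw] := Aw; split => //; rewrite component_layer //; right.
by rewrite component_layer //; right.
Qed.

Lemma strataP K : strata l K <-> exists2 w : V, torus w & K = layer (cell (level l w)).
Proof.
split=> [[/components_compl_SigmaP[w [tw _ ->]]|/components_SigmaP[w [tw _] ->]]|[w tw ->]].
- by exists w.
- by exists w.
have [Sw|Sw] := pselect (Sigma l w).
  by right; apply/components_SigmaP; exists w.
by left; apply/components_compl_SigmaP; exists w.
Qed.

End Strata.

(** * Corners *)

Section Corners.
Variables (R : realType) (n : nat) (l : 'rV[int]_n).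
Local Notation V := 'rV[R[i]^o]_n.
Local Notation N := (abs1 l).
Implicit Types (w : V) (K C : set V) (g : R -> V).

(** Translates between the signed angles in radians of [corner] and flipped angles in turns: each
    flip contributes a sign to the exponent. *)
Lemma turn_flip_flip (s m : int) (x : R) : `|s| = 1 -> m != 0 ->
  turn (flip m (flip s x)) = expi ((s * sgz m)%:~R * (2 * pi * x)).
Proof.
move=> s1 m0; rewrite turn_flip //.
have -> : turn (flip s x) = turn x ^ s.
  by rewrite -turn_flipMn [`|s|%N](_ : _ = 1%N) // ; lia.
rewrite exprz_exp.
have : s * sgz m = 1 \/ s * sgz m = -1 by case: sgzP m0; lia.
case=> ->; first by rewrite mul1r.
by rewrite -[LHS]/((turn x)^-1) -turnN /turn mulN1r mulrN.
Qed.

Lemma corner_angles (s : int) (e : R) w (j : 'I_n) : `|s| = 1 -> e <= 2 * pi ->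
  corner l s e w -> l 0 j != 0 ->
  0 < flip s (flip (l 0 j) (angles w 0 j)) < e / (2 * pi).
Proof.
move=> s1 e2 [tw cw] lj; have [t /andP[t0 te] wE] := cw j lj.
have p0 : 0 < 2 * pi :> R by rewrite mulr_gt0 ?pi_gt0.
have tE : t = 2 * pi * (t / (2 * pi)) by rewrite mulrC divfK ?gt_eqF.
(* The bound on [e] keeps this angle below one full turn, where [ang] inverts [turn]. *)
have x01 : 0 < t / (2 * pi) < 1.
  by rewrite divr_gt0 //= ltr_pdivrMr // mul1r (lt_le_trans te).
rewrite mxE wE tE -turn_flip_flip // ang_turn ?flip_itv // !flipK.
by rewrite divr_gt0 //= ltr_pM2r ?invr_gt0.
Qed.

Lemma diag_corner (s : int) (e x : R) : `|s| = 1 -> 0 < x < 1 ->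
  2 * pi * x < e -> corner l s e (cube_to_torus (diag l (flip s x))).
Proof.
move=> s1 x01 xe; split.
  by apply: torus_cube_to_torus; apply: cube_diag; rewrite flip_itv.
move=> j lj; exists (2 * pi * x).
  by rewrite xe andbT !mulr_gt0 ?pi_gt0 //; case/andP: x01.
by rewrite crd_cube_to_torus mxE turn_flip_flip.
Qed.

(** For s = 1 the levels near the corner lie between 0 and 1, for s = -1 between N - 1 and N. *)
Definition corner_cell (s : int) : int := if s < 0 then N%:Z + N%:Z - 1 else 1.

Lemma corner_cell_odd (s : int) : exists k : int, corner_cell s = k + k + 1.
Proof.
by rewrite /corner_cell; case: ifP => _; [exists (N%:Z - 1); ring|by exists 0].
Qed.

Lemma level_near0 w : 0 < level l w < 1 -> cell (level l w) = 1.
Proof. by move=> h; rewrite (@cell_itv _ 0). Qed.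

Hypothesis l0 : l != 0.

Lemma abs1R_gt0 : 0 < N%:R :> R.
Proof. by rewrite ltr0n abs1_gt0. Qed.

(** Chosen so that angles below it are less than 1 / N of a turn: their sum with total weight N then
    stays below 1. *)
Definition corner_radius : R := 2 * pi / N%:R.

Lemma corner_radius_gt0 : 0 < corner_radius.
Proof. by rewrite divr_gt0 ?abs1R_gt0 // mulr_gt0 ?pi_gt0. Qed.

Lemma corner_sub_layer (s : int) : `|s| = 1 ->
  corner l s corner_radius `<=` (layer l (corner_cell s) : set V).
Proof.
move=> s1 w cw; split; first by case: cw.
have p0 : 0 < 2 * pi :> R by rewrite mulr_gt0 ?pi_gt0.
have N0 := abs1R_gt0.
have r2 : corner_radius <= 2 * pi.
  by rewrite ler_pdivrMr // ler_peMr ?(ltW p0) // ler1n abs1_gt0.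
have rE : corner_radius / (2 * pi) = N%:R^-1.
  by rewrite /corner_radius mulrAC divff ?mul1r ?gt_eqF.
have aw j lj := @corner_angles s corner_radius w j s1 r2 cw lj.
have /andP[L0 L1] := level_itv w l0.
have NE : N%:R^-1 *+ N = 1 :> R by rewrite -[LHS]mulr_natr mulVf ?gt_eqF.
rewrite /corner_cell; move: aw; rewrite rE /flip.
case: ifP => s0 aw.
  rewrite (@cell_itv _ (N%:Z - 1)); first lia.
  rewrite subrK rmorphB /= -pmulrn L1 andbT.
  (* At the opposite corner every flipped angle of nonzero weight exceeds 1 - 1 / N, so the level
     exceeds N - 1. *)
  rewrite [ltLHS](_ : _ = \sum_j (1 - N%:R^-1) *+ `|l 0 j|); last first.
    by rewrite sumMn_const mulrnBl NE.
  by apply: sumMn_lt => // j lj; have /andP[_] := aw j lj; rewrite /flip; lra.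
apply: level_near0; rewrite L0 /= -NE -sumMn_const.
by apply: sumMn_lt => // j lj; have /andP[] := aw j lj.
Qed.

Lemma corner_nonempty (s : int) (e : R) : `|s| = 1 -> 0 < e ->
  exists w, corner l s e w /\ layer l (corner_cell s) w.
Proof.
move=> s1 e0; have r0 := corner_radius_gt0.
have p0 : 0 < 2 * pi :> R by rewrite mulr_gt0 ?pi_gt0.
(* The halving makes [m] strictly smaller than each bound: the diagonal point is then in the corner
   of radius [e] and in the one of radius [corner_radius]. *)
pose m := Num.min 1 (Num.min e corner_radius / (2 * pi)) / 2.
have m0 : 0 < m by rewrite divr_gt0 // lt_min ltr01 divr_gt0 // lt_min e0.
have [m1 m2] : m < 1 /\ m < Num.min e corner_radius / (2 * pi).
  apply/andP; rewrite -lt_min /m ltr_pdivrMr // ltr_pMr ?ltr1n //.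
  by rewrite lt_min ltr01 divr_gt0 // lt_min e0.
have [m3 m4] : 2 * pi * m < e /\ 2 * pi * m < corner_radius.
  by apply/andP; rewrite -lt_min mulrC -ltr_pdivlMr.
have m01 : 0 < m < 1 by rewrite m0.
exists (cube_to_torus (diag l (flip s m))); split; first exact: diag_corner.
by apply: corner_sub_layer => //; exact: diag_corner.
Qed.

(** Corners of every radius meet the layer of number [corner_cell s], which determines the
    component; that number is odd, so the layer lies off Sigma. *)
Lemma corner_componentP (s : int) C : `|s| = 1 ->
  corner_component l s C <-> C = layer l (corner_cell s).
Proof.
move=> s1; split=> [[/components_compl_SigmaP[w [tw _ ->]] [e e0 eC]]|->].
  have [v [ce lv]] := corner_nonempty s1 e0.
  by have [_ <-] := eC v ce; case: lv => _ ->.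
split; last by exists corner_radius; [exact: corner_radius_gt0|exact: corner_sub_layer].
have [v [_ [tv vE]]] := corner_nonempty s1 ltr01.
apply/components_compl_SigmaP; exists v; split => //; last by rewrite vE.
move=> /SigmaE[_ iv]; have [k kE] := corner_cell_odd s.
by move: vE; rewrite kE iv cell_int; lia.
Qed.

End Corners.

(** * Paths *)

Section Main.
Variables (R : realType) (n : nat) (l : 'rV[int]_n).
Local Notation V := 'rV[R[i]^o]_n.
Local Notation N := (abs1 l).
Implicit Types (w : V) (K C : set V) (g : R -> V).

Section Paths.
Variable g : R -> V.
Hypothesis cg : {within `[0, 1], continuous g}.
Hypothesis tg : forall t, 0 <= t <= 1 -> torus (g t).

Lemma continuous_level_path :
  {within `[0, 1], continuous (fun t => level l (g t))}.
Proof.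
rewrite continuous_subspace_in => t /set_mem; rewrite /= in_itv /= => t01.
by apply: continuous_level; [exact: tg|exact: cg].
Qed.

Lemma level_path_IVT (r s v : R) : 0 <= r -> r <= s -> s <= 1 ->
  Num.min (level l (g r)) (level l (g s)) <= v
    <= Num.max (level l (g r)) (level l (g s)) ->
  exists2 t, r <= t <= s & level l (g t) = v.
Proof.
move=> r0 rs s1 v_itv.
have [t] : exists2 t, t \in `[r, s] & level l (g t) = v.
  apply: IVT => //; apply: continuous_subspaceW continuous_level_path.
  by move=> t /=; rewrite !in_itv /= => /andP[rt ts]; rewrite (le_trans r0) ?(le_trans ts).
by rewrite in_itv /= => rts; exists t.
Qed.

Lemma level_path_left (a : R) : 0 < a <= 1 ->
  level l (g t) @[t --> a^'-] --> level l (g a).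
Proof.
move=> /andP[a0 a1].
have /(continuous_within_itvP _ a0)[] // :
    {within `[0, a], continuous (fun t => level l (g t))}.
apply: continuous_subspaceW continuous_level_path.
by move=> t /=; rewrite !in_itv /= => /andP[-> /le_trans->].
Qed.

Lemma level_path_right (b : R) : 0 <= b < 1 ->
  level l (g t) @[t --> b^'+] --> level l (g b).
Proof.
move=> /andP[b0 b1].
have /(continuous_within_itvP _ b1)[] // :
    {within `[b, 1], continuous (fun t => level l (g t))}.
apply: continuous_subspaceW continuous_level_path.
by move=> t /=; rewrite !in_itv /= => /andP[/(le_trans b0)-> ->].
Qed.

End Paths.
Hypothesis l0 : l != 0.

Lemma components_Sigma_layer K : components (Sigma l) K ->
  exists k : nat, [/\ (0 < k)%N, (k < N)%N & K = layer l (k%:Z + k%:Z)].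
Proof.
move=> /components_SigmaP[w /SigmaE[tw wE] ->].
have := level_itv w l0; rewrite wE; move: (Num.floor _) => k.
rewrite [N%:R]pmulrn ltr0z ltr_int cell_int; case: k => // k /andP[k0 kN].
by exists k; split.
Qed.

Lemma layer_Sigma_component (k : nat) w :
  layer l (k%:Z + k%:Z) w -> components (Sigma l) (layer l (k%:Z + k%:Z) : set V).
Proof.
move=> [tw wk]; apply/components_SigmaP; exists w; last by rewrite wk.
by apply/SigmaE; split => //; rewrite (cell_eq_even wk) intrKfloor.
Qed.

(** A first visit to level k comes from below, by intermediate values from a start below level 1; a
    last visit leaves upwards, because the path moves away. *)
Lemma moving_away_jumps g :
  moving_away l (layer l 1) g -> jumps l (rho_ l) g.
Proof.
move=> [cg tg [t0 g0] away] K /components_Sigma_layer[k [k0 kN ->]].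
have IVT := @level_path_IVT g cg tg.
have g0lt : level l (g 0) < 1 by have /andP[] := @cell_eq_odd _ _ 0 g0.
have k1 : 1 <= k%:R :> R by rewrite ler1n.
have rho_below t : 0 <= t <= 1 -> k%:R - 1 < level l (g t) < k%:R ->
    rho_ l (g t) = N%:Z - (k%:Z + k%:Z) + 1.
  move=> t01 tk; rewrite (rhoE l0 (tg _ t01)) (@cell_itv _ (k%:Z - 1)); first ring.
  by rewrite subrK rmorphB /= -pmulrn.
have rho_above t : 0 <= t <= 1 -> k%:R < level l (g t) < k%:R + 1 ->
    rho_ l (g t) = N%:Z - (k%:Z + k%:Z) - 1.
  move=> t01 tk; rewrite (rhoE l0 (tg _ t01)) (@cell_itv _ k%:Z); first ring.
  by rewrite rmorphD /= -pmulrn.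
have rho_at t : layer l (k%:Z + k%:Z) (g t) -> rho_ l (g t) = N%:Z - (k%:Z + k%:Z).
  by move=> [tgt e]; rewrite rhoE // e.
have layer_at t : 0 <= t <= 1 -> level l (g t) = k%:R -> layer l (k%:Z + k%:Z) (g t).
  by move=> t01 e; split; [exact: tg|rewrite e pmulrn cell_int].
split=> [a a01 ka Na|b b01 kb Nb].
  have /andP[a0 a1] := a01.
  have aE : level l (g a) = k%:R := cell_eq_even ka.2.
  have below t : 0 <= t < a -> level l (g t) < k%:R.
    move=> /andP[t0' ta]; rewrite ltNge; apply/negP => kt.
    have [||||u /andP[u0 ut] uE] := IVT 0 t k%:R => //.
    - by rewrite (le_trans (ltW ta)).
    - by rewrite ge_min le_max kt orbT (le_trans (ltW g0lt)).
    apply: (Na u); first by rewrite u0 (le_lt_trans ut).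
    by apply: layer_at => //; rewrite u0 (le_trans ut) // (le_trans (ltW ta)).
  have lim := level_path_left cg tg a01; rewrite aE in lim.
  rewrite rho_at //; near=> t.
  have [ta tpos] : t < a /\ 0 < t.
    by split; near: t; [exact: nbhs_left_lt|exact: nbhs_left_gt].
  rewrite rho_below ?addrK //; first by rewrite (ltW tpos) (ltW (lt_le_trans ta a1)).
  rewrite below ?(ltW tpos) // andbT; near: t.
  by apply: (cvgr_gt _ lim); rewrite ltrBlDr ltrDl.
have /andP[b0 b1] := b01.
have bE : level l (g b) = k%:R := cell_eq_even kb.2.
have above t : b < t <= 1 -> k%:R < level l (g t).
  move=> /andP[bt t1]; rewrite ltNge; apply/negP => tk.
  have {}tk : level l (g t) < k%:R.
    rewrite lt_neqAle tk andbT; apply/eqP => tE; apply: (Nb t); first by rewrite bt t1.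
    by apply: layer_at => //; rewrite t1 (le_trans b0 (ltW bt)).
  (* The path meets the stratum just below level k both before and after b, hence at b. *)
  have cell_below u : k%:R - 2^-1 <= level l (g u) < k%:R ->
      cell (level l (g u)) = k%:Z + k%:Z - 1.
    move=> /andP[ku uk]; rewrite (@cell_itv _ (k%:Z - 1)); first ring.
    by rewrite subrK rmorphB /= -pmulrn uk andbT; lra.
  (* The target is at least k - 1/2, hence in the slab just below k, and at least the starting
     level, hence attained before [b]. *)
  have [||||r /andP[r0 rb] rE] := IVT 0 b (Num.max (level l (g 0)) (k%:R - 2^-1)) => //.
  - exact: ltW.
  - rewrite bE ge_min ge_max !le_max !lexx /=.
    by apply/orP; right; rewrite lerBlDr lerDl invr_ge0.
  have [||||u /andP[bu ut] uE] := IVT b t (Num.max (level l (g t)) (k%:R - 2^-1)) => //.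
  - exact: ltW.
  - rewrite bE ge_min ge_max !le_max !lexx !orbT /=.
    by apply/orP; left; rewrite lerBlDr lerDl invr_ge0.
  have r_below : cell (level l (g r)) = k%:Z + k%:Z - 1.
    by apply: cell_below; rewrite rE le_max lexx orbT gt_max (lt_le_trans g0lt) //=; lra.
  have u_below : cell (level l (g u)) = k%:Z + k%:Z - 1.
    by apply: cell_below; rewrite uE le_max lexx orbT gt_max tk /=; lra.
  have r01 : 0 <= r <= 1 by rewrite r0 (le_trans rb) // ltW.
  have u01 : 0 <= u <= 1 by rewrite (le_trans b0) // (le_trans ut).
  (* The contradiction is that [g b] would have the odd number 2k - 1 as well as the even number
     2k. *)
  have [] : layer l (cell (level l (g r))) (g b).
    have sr : strata l (layer l (cell (level l (g r))) : set V).
      by apply/strataP; exists (g r) => //; exact: tg.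
    apply: (away _ sr r b u r0 rb bu (le_trans ut t1)).
      by apply: mem_layer; exact: tg.
    by split; [exact: tg|rewrite u_below].
  by move=> _; rewrite r_below kb.2 -[LHS]addr0 => /addrI.
have lim := level_path_right cg tg b01; rewrite bE in lim.
near=> t.
have [tb t1] : b < t /\ t < 1.
  by split; near: t; [exact: nbhs_right_gt|exact: nbhs_right_lt].
rewrite [in RHS]rho_at // rho_above //; first by rewrite (ltW t1) (ltW (le_lt_trans b0 tb)).
rewrite above ?tb ?ltW //=; near: t.
by apply: (cvgr_lt _ lim); rewrite ltrDl.
Unshelve. all: by end_near. Qed.

End Main.

(** * Diagonal path and uniqueness *)

Section Characterization.
Variables (R : realType) (n : nat) (l : 'rV[int]_n).
Hypothesis l0 : l != 0.
Local Notation V := 'rV[R[i]^o]_n.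
Local Notation N := (abs1 l).
Implicit Types (w : V) (K C : set V) (g : R -> V).

(** With these endpoints the level runs from 1/2 to N - 1/2, from the middle of the first slab to
    the middle of the last. *)
Definition diagonal : R -> V :=
  segment (diag l (2 * N%:R)^-1) (diag l (1 - (2 * N%:R)^-1)).

Lemma diagonal_level (t : R) : 0 <= t <= 1 ->
  torus (diagonal t) /\ level l (diagonal t) = 2^-1 + t * (N%:R - 1).
Proof.
move=> t01; have N0 : 0 < N%:R :> R := abs1R_gt0 R l0.
have N1 : 1 <= N%:R :> R by rewrite ler1n abs1_gt0.
have e0 : 0 < (2 * N%:R)^-1 :> R by rewrite invr_gt0 mulr_gt0.
have e1 : (2 * N%:R)^-1 < 1 :> R by rewrite invf_lt1 ?mulr_gt0 //; lra.
have c0 : cube (diag l (2 * N%:R)^-1 : 'rV[R]_n) by apply: cube_diag; rewrite e0.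
have c1 : cube (diag l (1 - (2 * N%:R)^-1) : 'rV[R]_n).
  by apply: cube_diag; rewrite subr_gt0 e1 /= ltrBlDr ltrDl.
have c := cube_segment c0 c1 t01.
split; first exact: torus_cube_to_torus.
rewrite /diagonal /segment level_cube_to_torus // height_segment !height_diag.
have eN : (2 * N%:R)^-1 *+ N = 2^-1 :> R.
  by rewrite -[LHS]mulr_natr invfM mulfVK // gt_eqF.
by rewrite mulrnBl eN; lra.
Qed.

Lemma diagonal_at (v : R) : 2^-1 <= v <= N%:R - 2^-1 ->
  exists2 t, 0 <= t <= 1 & level l (diagonal t) = v.
Proof.
move=> /andP[v0 v1]; have N1 : 1 <= N%:R :> R by rewrite ler1n abs1_gt0.
(* For N = 1 the level is constantly 1/2, and the linear equation for [t] cannot be solved by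
   division. *)
have [N1'|N2] := eqVneq (N%:R : R) 1.
  exists 0; first by rewrite lexx ler01.
  by rewrite (diagonal_level _).2 ?lexx ?ler01 //; lra.
have N0 : 0 < N%:R - 1 :> R by rewrite subr_gt0 lt_neqAle eq_sym N2.
have t01 : 0 <= (v - 2^-1) / (N%:R - 1) <= 1.
  by rewrite divr_ge0 ?(ltW N0) ?subr_ge0 //= ler_pdivrMr // mul1r; lra.
exists ((v - 2^-1) / (N%:R - 1)) => //.
by rewrite (diagonal_level t01).2 divfK ?gt_eqF // addrC subrK.
Qed.

Lemma diagonal_mono (s t : R) : 0 <= s -> s <= t -> t <= 1 ->
  level l (diagonal s) <= level l (diagonal t).
Proof.
move=> s0 st t1; have N1 : 1 <= N%:R :> R by rewrite ler1n abs1_gt0.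
have s01 : 0 <= s <= 1 by rewrite s0 (le_trans st).
have t01 : 0 <= t <= 1 by rewrite t1 (le_trans s0).
rewrite (diagonal_level s01).2 (diagonal_level t01).2.
by rewrite lerD2l ler_wpM2r // subr_ge0.
Qed.

(** The level, hence its cell, is monotone along the path; equal cells at [r] and [t] force the same
    cell in between. *)
Lemma diagonal_moving_away : moving_away l (layer l 1) diagonal.
Proof.
split.
- by apply: continuous_subspaceT; exact: continuous_segment.
- by move=> t /diagonal_level[].
- have [|t0 e] := @diagonal_level 0; first by rewrite lexx ler01.
  split => //; apply: level_near0; rewrite e mul0r addr0; lra.
move=> K /strataP[w tw ->] r s t r0 rs st t1 [_ rw] [_ tw'].
split; first by have [] := @diagonal_level s; rewrite ?(le_trans r0) ?(le_trans st).
apply/eqP; rewrite eq_le -{1}tw' -rw !le_cell //.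
  exact: diagonal_mono r0 rs (le_trans st t1).
exact: diagonal_mono (le_trans r0 rs) st t1.
Qed.

Lemma rho_bounds w : torus w -> 1 - N%:Z <= rho_ l w <= N%:Z - 1.
Proof.
move=> tw; rewrite rhoE //; have /andP[L0 L1] := level_itv w l0.
case: (cellP (level l w)) => [k kE|k /andP[k0 k1]].
  by move: L0 L1; rewrite kE ltr0z [N%:R]pmulrn ltr_int {tw kE}; lia.
have : 0 < (k + 1)%:~R :> R := lt_trans L0 k1.
have : k%:~R < N%:Z%:~R :> R by exact: lt_trans k0 L1.
by rewrite ltr_int ltr0z {tw k0 k1 L0 L1}; lia.
Qed.

Lemma rho_characterizing_props : characterizing_props l (@rho_ R n l).
Proof.
split.
- by move=> K /strataP[w0 _ ->] w w' [tw wE] [tw' wE']; rewrite !rhoE // wE wE'.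
- split; last by move=> w /rho_bounds /andP[].
  exists (corner_radius R l); first exact: corner_radius_gt0.
  by move=> w /(corner_sub_layer l0 (normr1 _))[tw wE]; rewrite rhoE // wE.
exists (layer l (corner_cell l 1)), (layer l (corner_cell l (-1))); split.
- by apply/corner_componentP.
- by apply/corner_componentP.
- by move=> g; exact: moving_away_jumps.
- exists diagonal; first exact: diagonal_moving_away.
  have [|td e] := @diagonal_level 1; first by rewrite ler01 lexx.
  (* The diagonal ends at level N - 1/2, in the last slab. *)
  split => //; rewrite e (@cell_itv _ (N%:Z - 1)); first by rewrite /corner_cell /= {e}; lia.
  by rewrite subrK rmorphB /= -pmulrn; lra.
split=> w; last by move=> /rho_bounds /andP[].
by move=> [tw wE]; rewrite rhoE // wE /corner_cell /= {wE tw}; lia.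
Qed.

(** * Uniqueness of the function *)

Section Uniqueness.
Variable f : V -> int.
Hypothesis fP : characterizing_props l f.

Lemma layer_constant (c : int) w w' : layer l c w -> layer l c w' -> f w = f w'.
Proof.
have [fc _ _] := fP => lw lw'; have [tw wE] := lw.
by apply: fc lw lw'; apply/strataP; exists w => //; rewrite wE.
Qed.

(** The corner component is unique, so the starting component provided by the third property is the
    slab where the diagonal starts. *)
Lemma jumps_diagonal : jumps l f diagonal.
Proof.
have [_ _ [C [D [cC _ fj _ _]]]] := fP.
have [/(_ cC) CE _] := corner_componentP l0 C (normr1 _).
by apply: fj; rewrite CE; exact: diagonal_moving_away.
Qed.

(** The level increases strictly, so the diagonal meets the hyperplane of level k at a single
    parameter, where both the entering and the exiting jump apply. *)
Lemma diagonal_crossing (k : nat) : (0 < k)%N -> (k < N)%N ->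
  exists w1 w2 w3, [/\ layer l (k%:Z + k%:Z - 1) w1, layer l (k%:Z + k%:Z) w2,
    layer l (k%:Z + k%:Z + 1) w3, f w2 = f w1 - 1 & f w3 = f w2 - 1].
Proof.
move=> k0 kN; have k1 : 1 <= k%:R :> R by rewrite ler1n.
have kN1 : k%:R + 1 <= N%:R :> R by rewrite natr1 ler_nat.
have [a a01 aE] : exists2 t, 0 <= t <= 1 & level l (diagonal t) = k%:R.
  by apply: diagonal_at; apply/andP; split; lra.
(* From 0 < k < N follows N >= 2, which makes the monotonicity strict. *)
have N2 : 0 < N%:R - 1 :> R by lra.
have dlt s t : 0 <= s <= 1 -> 0 <= t <= 1 ->
    (level l (diagonal s) < level l (diagonal t)) = (s < t).
  move=> s01 t01; rewrite (diagonal_level s01).2 (diagonal_level t01).2.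
  by rewrite ltrD2l ltr_pM2r.
have z01 : 0 <= (0 : R) <= 1 by rewrite lexx ler01.
have u01 : 0 <= (1 : R) <= 1 by rewrite lexx ler01.
have /andP[a0 a1] := a01.
have a0' : 0 < a by rewrite -dlt // aE (diagonal_level z01).2; lra.
have a1' : a < 1 by rewrite -dlt // aE (diagonal_level u01).2; lra.
have ka : layer l (k%:Z + k%:Z) (diagonal a).
  by split; [exact: (diagonal_level a01).1|rewrite aE pmulrn cell_int].
have [jl jr] := jumps_diagonal (layer_Sigma_component ka).
have [cg tg _ _] := diagonal_moving_away.
have Nl t : 0 <= t < a -> ~ layer l (k%:Z + k%:Z) (diagonal t).
  move=> /andP[t0 ta] [_ /cell_eq_even tE].
  have : level l (diagonal t) < level l (diagonal a).
    by rewrite dlt // t0 (ltW (lt_le_trans ta a1)).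
  by rewrite tE aE ltxx.
have Nr t : a < t <= 1 -> ~ layer l (k%:Z + k%:Z) (diagonal t).
  move=> /andP[ta t1] [_ /cell_eq_even tE].
  have : level l (diagonal a) < level l (diagonal t).
    by rewrite dlt // t1 (ltW (le_lt_trans a0 ta)).
  by rewrite tE aE ltxx.
have [s [s0 sa sk fs]] : exists s, [/\ 0 < s, s < a, k%:R - 1 < level l (diagonal s) &
    f (diagonal a) = f (diagonal s) - 1].
  (* The jump holds only near [a], so [s] is taken close enough to have both the jump and a level
     above k - 1. *)
  apply: (@filter_ex _ a^'-); near=> s; split; near: s.
  - exact: nbhs_left_gt.
  - exact: nbhs_left_lt.
  - have a01' : 0 < a <= 1 by rewrite a0'.
    have := @level_path_left _ _ l _ cg tg _ a01'; rewrite aE => lim.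
    by apply: (cvgr_gt _ lim); rewrite ltrBlDr ltrDl.
  by apply: jl => //; rewrite a0'.
have [t [ta t1 kt ft]] : exists t, [/\ a < t, t < 1, level l (diagonal t) < k%:R + 1 &
    f (diagonal t) = f (diagonal a) - 1].
  apply: (@filter_ex _ a^'+); near=> t; split; near: t.
  - exact: nbhs_right_gt.
  - exact: nbhs_right_lt.
  - have a01' : 0 <= a < 1 by rewrite a0.
    have := @level_path_right _ _ l _ cg tg _ a01'; rewrite aE => lim.
    by apply: (cvgr_lt _ lim); rewrite ltrDl.
  by apply: jr => //; rewrite a0.
have s01 : 0 <= s <= 1 by rewrite (ltW s0) (ltW (lt_le_trans sa a1)).
have t01 : 0 <= t <= 1 by rewrite (ltW t1) (ltW (le_lt_trans a0 ta)).
exists (diagonal s), (diagonal a), (diagonal t); split => //.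
  split; first exact: (diagonal_level s01).1.
  rewrite (@cell_itv _ (k%:Z - 1)); first ring.
  by rewrite subrK rmorphB /= -pmulrn sk -aE dlt.
split; first exact: (diagonal_level t01).1.
by rewrite (@cell_itv _ k%:Z) // rmorphD /= -pmulrn kt -aE dlt // ta.
Unshelve. all: by end_near. Qed.

(** Induction over the slabs: the maximum at the corner gives the first value, and each crossing of
    a hyperplane lowers it by 2. *)
Lemma odd_layer_value (k : nat) : (k < N)%N -> forall w,
  layer l (k%:Z + k%:Z + 1) w -> f w = N%:Z - (k%:Z + k%:Z + 1).
Proof.
elim: k => [_ w lw|k IH kN w lw].
  have [_ [[e e0 fe] _] _] := fP.
  have [v [ce lv]] := corner_nonempty l0 (normr1 _) e0.
  by rewrite (layer_constant lw lv) fe.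
have [w1 [w2 [w3 [lw1 lw2 lw3 f2 f3]]]] := diagonal_crossing (ltn0Sn k) kN.
rewrite (layer_constant lw lw3) f3 f2 (IH (ltnW kN)).
  by rewrite -[k.+1]addn1 PoszD; ring.
by move: lw1; rewrite -[k.+1]addn1 PoszD [_ - 1](_ : _ = k%:Z + k%:Z + 1) //; ring.
Qed.

(** The value on a hyperplane is 1 more than on the slab entered on exiting it. *)
Lemma even_layer_value (k : nat) : (0 < k)%N -> (k < N)%N -> forall w,
  layer l (k%:Z + k%:Z) w -> f w = N%:Z - (k%:Z + k%:Z).
Proof.
move=> k0 kN w lw.
have [w1 [w2 [w3 [_ lw2 lw3 _ f3]]]] := diagonal_crossing k0 kN.
rewrite (layer_constant lw lw2) -[LHS](subrK 1) -f3 (odd_layer_value kN lw3).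
by ring.
Qed.

Lemma characterizing_props_rho w : torus w -> f w = rho_ l w.
Proof.
move=> tw; rewrite rhoE //; have := level_itv w l0.
have := mem_layer l tw; case: cellP => [k -> lw|k /andP[k0 k1] lw /andP[L0 L1]].
  rewrite [N%:R]pmulrn ltr0z ltr_int; case: k lw => // k lw /andP[k0 kN].
  exact: even_layer_value.
have : 0 < (k + 1)%:~R :> R := lt_trans L0 k1.
have : k%:~R < N%:Z%:~R :> R by exact: lt_trans k0 L1.
rewrite ltr_int ltr0z; case: k lw {k0 k1} => [k|k] lw kN k0 //.
  exact: odd_layer_value.
(* A negative index is excluded because the level is positive. *)
by move: k0; rewrite NegzE -[k.+1]addn1 PoszD opprD subrK ltrNr oppr0.
Qed.

End Uniqueness.

Lemma Sigma_hyperplanes_level : Sigma_hyperplanes R l.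
Proof.
(* The integer levels attained are 1, ..., N - 1, whence the shift of [i]; subtracting [neg1] passes
   from the height to the linear form. *)
pose c (i : 'I_N.-1) : R := i.+1%:R - (neg1 l)%:R.
have hyperplaneE i (a : 'rV[R]_n) : hyperplane l (c i) a <->
    cube a /\ height l a = i.+1%:R.
  rewrite height_linear /c; split=> -[ca h]; split => //.
    by rewrite h subrK.
  by rewrite /= -h addrK.
have ltN (i : 'I_N.-1) : (i.+1 < N)%N by rewrite -ltn_predRL.
exists c; split.
- by move=> i j /addIr /eqP; rewrite eqr_nat => /eqP[]; exact: val_inj.
- move=> i; have N0 : 0 < N%:R :> R := abs1R_gt0 R l0.
  exists (diag l (i.+1%:R / N%:R)); apply/hyperplaneE; split.
    by apply: cube_diag; rewrite divr_gt0 ?ltr0Sn //= ltr_pdivrMr // mul1r ltr_nat ltN.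
  by rewrite height_diag -[LHS]mulr_natr divfK ?gt_eqF.
apply/seteqP; split=> [w /SigmaE[tw wE]|w [i _ [a /hyperplaneE[ca ha] <-]]].
  have := level_itv w l0; rewrite wE [N%:R]pmulrn ltr0z ltr_int.
  case E : (Num.floor _) => [[|k]|k] // /andP[_ kN].
  have kN' : (k < N.-1)%N by rewrite ltn_predRL.
  exists (Ordinal kN') => //; exists (angles w); last exact: cube_to_torus_angles.
  apply/hyperplaneE; split; first exact: cube_angles.
  by rewrite -[LHS]/(level l w) wE E.
apply/SigmaE; split; first exact: torus_cube_to_torus.
by rewrite level_cube_to_torus // ha pmulrn intrKfloor.
Qed.

End Characterization.

Theorem mainTheorem8 (R : realType) (mu : nat) (hmu : (2 <= mu)%N)
    (l : 'rV[int]_(mu.-1)) (hl : l != 0) :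
  [/\ Sigma_hyperplanes R l,
      characterizing_props l (@rho_ R mu.-1 l) &
      forall f : 'rV[R[i]^o]_(mu.-1) -> int,
        characterizing_props l f ->
        forall w, torus w -> f w = rho_ l w].
Proof.
split; first exact: Sigma_hyperplanes_level.
  exact: rho_characterizing_props.
exact: characterizing_props_rho.
Qed.
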